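(* Let $\Theta$ be a simplicial theory. Then $\Theta$ is causal, i.e. every system $A\in\mathsf{Sys}(\Theta)$ admits of a unique deterministic effect.
   Context: **Operational probabilistic theories (OPTs).** An OPT $\Theta$ consists of a class $\mathsf{Sys}(\Theta)$ of systems $A,B,\dots$ with a trivial system $I$ and an associative composition $(A,B)\mapsto AB$ with unit $I$ (systems may be reordered by deterministic swaps), and, for each pair $A,B$, a collection of tests $\{E_x\}_{x\in X}$ ($X$ a finite outcome set) made of events $E_x$ from $A$ to $B$; every event belongs to some test. Tests can be composed sequentially ($\circ$) and in parallel ($\boxtimes$), with identity events and the law $(\mathcal A\boxtimes\mathcal B)\circ(\mathcal C\boxtimes\mathcal D)=(\mathcal A\circ\mathcal C)\boxtimes(\mathcal B\circ\mathcal D)$ (a strict symmetric monoidal structure). Events from $I$ to $I$ are probabilities in $[0,1]$, composed by multiplication, and every test from $I$ to $I$ is a probability distribution. For a test $\{E_x\}_{x\in X}$ and $Y\subseteq X$ the coarse-graining $\sum_{y\in Y}E_y$ is an event (merging outcomes of a test gives a test), and both compositions distribute over sums. Events giving the same probabilities in all contexts are identified. States $\rho\in\mathsf{St}(A)$ are (classes of) events from $I$ to $A$; effects $a\in\mathsf{Eff}(A)$ are (classes of) events from $A$ to $I$; $(a|\rho)\in[0,1]$ is the resulting probability. Effects separate states and states separate effects, so $\mathsf{St}(A)$ is a subset of the real vector space $\mathsf{St}_{\mathbb R}(A)=\mathrm{span}_{\mathbb R}\,\mathsf{St}(A)$ and effects are linear functionals on it; sums of events are vector sums. $D_A=\dim\mathsf{St}_{\mathbb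 R}(A)$ is assumed finite for all $A$. The null state $\varepsilon=0$ always belongs to $\mathsf{St}(A)$. An event is deterministic if it forms a test with a single outcome (so the full coarse-graining of a test is deterministic); compositions of deterministic events are deterministic; a state is deterministic iff every deterministic effect takes value $1$ on it. Every system has at least one preparation test (input $I$) and one observation test (output $I$). $\mathsf{St}(A)$ need not be convex. **Extremal states.** $\mathrm{Conv}(\mathsf{St}(A))$ is the convex hull of $\mathsf{St}(A)$, and $\mathsf{ExtSt}(A)$ is the set of its extreme points (the extremal states), which includes the null state $0$. **Simplicial theory.** An OPT is simplicial if for every system $A$ the extremal states $\mathsf{ExtSt}(A)$ are the vertices of a $D_A$-simplex, i.e. there are exactly $D_A+1$ of them (including the null state), they are affinely independent, and their convex hull is $\mathrm{Conv}(\mathsf{St}(A))$. *)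

(* Defs.v *)
From HB Require Import structures.
From mathcomp Require Import all_boot all_order all_algebra.
From mathcomp Require Import boolp classical_sets functions reals convex.

Set Implicit Arguments.
Unset Strict Implicit.
Unset Printing Implicit Defensive.

Import Order.TTheory GRing.Theory Num.Theory.
Local Open Scope ring_scope.

Definition castHom (S : Type) (hom : S -> S -> Type) (A A' B B' : S)
    (eA : A = A') (eB : B = B') (f : hom A B) : hom A' B' :=
  ecast X (hom X B') eA (ecast Y (hom A Y) eB f).

(* The monoidal structure is strict: associativity and unit laws are equalities
   of systems, along which events are transported by castHom. *)
Record strictSymMonCat := StrictSymMonCat {
  sys : Type;
  triv : sys;
  tens : sys -> sys -> sys;
  tensA : forall A B C, tens A (tens B C) = tens (tens A B) C;
  tensIs : forall A, tens triv A = A;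
  tenssI : forall A, tens A triv = A;

  ev : sys -> sys -> Type;
  idev : forall A, ev A A;
  (* seqc g f is "g after f" *)
  seqc : forall A B C, ev B C -> ev A B -> ev A C;
  parc : forall A B A' B', ev A B -> ev A' B' -> ev (tens A A') (tens B B');
  swap : forall A B, ev (tens A B) (tens B A);

  seqcA : forall A B C D (h : ev C D) (g : ev B C) (f : ev A B),
    seqc h (seqc g f) = seqc (seqc h g) f;
  seqcIl : forall A B (f : ev A B), seqc (idev B) f = f;
  seqcIr : forall A B (f : ev A B), seqc f (idev A) = f;

  parc_id : forall A B, parc (idev A) (idev B) = idev (tens A B);
  parc_seqc : forall A B C A' B' C'
      (g : ev B C) (f : ev A B) (g' : ev B' C') (f' : ev A' B'),
    seqc (parc g g') (parc f f') = parc (seqc g f) (seqc g' f');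
  parcA : forall A1 B1 A2 B2 A3 B3 (f : ev A1 B1) (g : ev A2 B2) (h : ev A3 B3),
    castHom (tensA A1 A2 A3) (tensA B1 B2 B3) (parc f (parc g h))
    = parc (parc f g) h;
  parcIl : forall A B (f : ev A B),
    castHom (tensIs A) (tensIs B) (parc (idev triv) f) = f;
  parcIr : forall A B (f : ev A B),
    castHom (tenssI A) (tenssI B) (parc f (idev triv)) = f;

  swap_nat : forall A B A' B' (f : ev A B) (f' : ev A' B'),
    seqc (swap B B') (parc f f') = seqc (parc f' f) (swap A A');
  swapK : forall A B, seqc (swap B A) (swap A B) = idev (tens A B);
  swap_tens : forall A B C,
    castHom (esym (tensA A B C)) (tensA B C A)
      (seqc (parc (idev B) (swap A C))
            (castHom erefl (esym (tensA B A C)) (parc (swap A B) (idev C))))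
    = swap A (tens B C)
}.

Arguments ev {s} A B.
Arguments triv {s}.

(* coarse t Y stands for the sum of the t y with y in Y; its value is only
   constrained when t is a test.  The set Y may be empty, in which case
   coarse t Y is the null event. *)
Record opt (R : realType) := Opt {
  opt_cat :> strictSymMonCat;
  test : forall (A B : sys opt_cat) (X : finType), (X -> ev A B) -> Prop;
  coarse : forall (A B : sys opt_cat) (X : finType),
    (X -> ev A B) -> {set X} -> ev A B;
  prob : ev (@triv opt_cat) triv -> R;

  ev_in_test : forall (A B : sys opt_cat) (E : ev A B),
    exists (X : finType) (t : X -> ev A B), test t /\ exists x, t x = E;
  test_id : forall A : sys opt_cat, test (fun _ : unit => idev A);
  test_swap : forall A B : sys opt_cat, test (fun _ : unit => swap A B);
  test_seqc : forall (A B C : sys opt_cat) (X Y : finType)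
      (t : X -> ev A B) (u : Y -> ev B C),
    test t -> test u -> test (fun p : X * Y => seqc (u p.2) (t p.1));
  test_parc : forall (A B A' B' : sys opt_cat) (X Y : finType)
      (t : X -> ev A B) (u : Y -> ev A' B'),
    test t -> test u -> test (fun p : X * Y => parc (t p.1) (u p.2));

  preparation_test : forall A : sys opt_cat,
    exists (X : finType) (t : X -> ev triv A), test t;
  observation_test : forall A : sys opt_cat,
    exists (X : finType) (t : X -> ev A triv), test t;

  prob_inj : injective prob;
  prob_ge0 : forall p, 0 <= prob p;
  prob_le1 : forall p, prob p <= 1;
  prob_seqc : forall p q, prob (seqc p q) = prob p * prob q;
  prob_parc : forall p q,
    prob (castHom (tensIs triv) (tensIs triv) (parc p q)) = prob p * prob q;
  prob_test : forall (X : finType) (t : X -> ev triv triv),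
    test t -> \sum_x prob (t x) = 1;

  coarse1 : forall (A B : sys opt_cat) (X : finType) (t : X -> ev A B) (x : X),
    test t -> coarse t [set x] = t x;
  test_merge : forall (A B : sys opt_cat) (X Z : finType) (t : X -> ev A B)
      (f : X -> Z),
    test t -> (forall z, exists x, f x = z) ->
    test (fun z => coarse t [set x | f x == z]);
  prob_coarse : forall (X : finType) (t : X -> ev triv triv) (Y : {set X}),
    test t -> prob (coarse t Y) = \sum_(y in Y) prob (t y);
  coarse_seqc : forall (A B C : sys opt_cat) (X Y : finType)
      (t : X -> ev A B) (u : Y -> ev B C) (X' : {set X}) (Y' : {set Y}),
    test t -> test u ->
    coarse (fun p : X * Y => seqc (u p.2) (t p.1)) (finset.setX X' Y')
    = seqc (coarse u Y') (coarse t X');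
  coarse_parc : forall (A B A' B' : sys opt_cat) (X Y : finType)
      (t : X -> ev A B) (u : Y -> ev A' B') (X' : {set X}) (Y' : {set Y}),
    test t -> test u ->
    coarse (fun p : X * Y => parc (t p.1) (u p.2)) (finset.setX X' Y')
    = parc (coarse t X') (coarse u Y');

  (* Events giving the same probabilities in all contexts are identified. *)
  ev_ext : forall (A B : sys opt_cat) (E F : ev A B),
    (forall (C : sys opt_cat) (rho : ev triv (tens A C)) (a : ev (tens B C) triv),
       prob (seqc a (seqc (parc E (idev C)) rho))
       = prob (seqc a (seqc (parc F (idev C)) rho))) ->
    E = F
}.

Local Open Scope classical_set_scope.

Section LinearConvex.
Variables (R : realType) (V : lmodType R).

Definition lin_span (S : set V) : set V :=
  smallest [set W : set V | GRing.submod_closed [in W]] S.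

Definition lin_indep (d : nat) (e : 'I_d -> V) : Prop :=
  forall c : 'I_d -> R, \sum_i c i *: e i = 0 -> forall i, c i = 0.

Definition has_dim (W : set V) (d : nat) : Prop :=
  exists e : 'I_d -> V, lin_indep e /\ lin_span (range e) = W.

Definition convex_hull (S : set V) : set V := smallest (@convex_set R V) S.

Definition extreme_points (K : set V) : set V :=
  [set x | K x /\ forall y z (t : R), K y -> K z -> 0 < t < 1 ->
     t *: y + (1 - t) *: z = x -> y = x /\ z = x].

Definition affine_indep (n : nat) (v : 'I_n -> V) : Prop :=
  forall c : 'I_n -> R, \sum_i c i = 0 -> \sum_i c i *: v i = 0 ->
    forall i, c i = 0.

End LinearConvex.

Section OPT.
Variables (R : realType) (T : opt R).
Implicit Type A : sys T.

Definition deterministic (A B : sys T) (E : ev A B) : Prop :=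
  test (fun _ : unit => E).

Definition pairing A (a : ev A triv) (rho : ev triv A) : R :=
  prob (seqc a rho).

(* States live in the real vector space of functions on effects: since effects
   separate states, rho is identified with the function a |-> (a|rho). *)
Definition state_vec A (rho : ev triv A) : ev A triv -> R^o :=
  fun a => pairing a rho.

Definition St A : set (ev A triv -> R^o) := range (@state_vec A).
Arguments St : clear implicits.

Definition StR A : set (ev A triv -> R^o) := lin_span (St A).
Arguments StR : clear implicits.

Definition ExtSt A : set (ev A triv -> R^o) :=
  extreme_points (convex_hull (St A)).
Arguments ExtSt : clear implicits.

Definition finite_dimensional : Prop :=
  forall A, exists d, has_dim (StR A) d.

Definition simplicial : Prop :=
  forall A (D : nat), has_dim (StR A) D ->
    exists v : 'I_D.+1 -> (ev A triv -> R^o),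
      [/\ injective v, range v = ExtSt A, affine_indep v
        & convex_hull (range v) = convex_hull (St A)].

Definition causal : Prop :=
  forall A, exists! e : ev A triv, deterministic e.

End OPT.

(* Main.v *)
(* A nonzero vertex v of the simplex of states occurs in some test; the sum w of
   the other outcomes and the total v + w are again states.  Since 0 is also a
   vertex, comparing coordinates in the simplex forces w = 0, so v is a full
   coarse-graining and every deterministic effect takes value 1 on it.  Two
   deterministic effects thus agree on all vertices, hence on all states. *)

Require Import Defs.
From mathcomp Require Import all_boot all_order all_algebra reals.
From mathcomp Require Import boolp classical_sets functions convex.
From mathcomp Require Import interval_inference lra.

Set Implicit Arguments.
Unset Strict Implicit.
Unset Printing Implicit Defensive.

Import Order.TTheory GRing.Theory Num.Theory.
Local Open Scope classical_set_scope.
Local Open Scope ring_scope.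

(** * Convex hulls, extreme points and simplex coordinates *)

Section Convexity.
Variables (R : realType) (V : lmodType R).
Implicit Types (S K : set V) (x y z : V) (t : R).

Lemma convex_setE K : @convex_set R V K <->
  forall x y t, 0 <= t <= 1 -> K x -> K y -> K (t *: x + (1 - t) *: y).
Proof.
split=> [cK x y t t01 Kx Ky | cK x y t /set_mem Kx /set_mem Ky].
  have [t0 t1] := andP t01.
  pose p : {i01 R} := Itv01 t0 t1.
  by have := cK x y p (mem_set Kx) (mem_set Ky) => /set_mem.
by apply/mem_set/(cK x y t%:inum) => //; apply/andP; split.
Qed.

Lemma convex_hull_conv S x y t : 0 <= t <= 1 ->
  convex_hull S x -> convex_hull S y -> convex_hull S (t *: x + (1 - t) *: y).
Proof.
move=> t01 hx hy K [cK SK].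
by move/convex_setE: (cK); apply=> //; [exact: hx | exact: hy].
Qed.

Lemma sub_convex_hull S : S `<=` convex_hull S.
Proof. exact: sub_gen_smallest. Qed.

Lemma convex_hull_sub S K :
  (forall x y t, 0 <= t <= 1 -> K x -> K y -> K (t *: x + (1 - t) *: y)) ->
  S `<=` K -> convex_hull S `<=` K.
Proof. by move=> cK SK; apply: smallest_sub => //; apply/convex_setE. Qed.

(* If an extreme point x were not in S, removing it from the hull would leave a
   smaller convex set containing S. *)
Lemma extreme_points_hull S : extreme_points (convex_hull S) `<=` S.
Proof.
move=> x [hx ext]; apply: contrapT => Sx.
have /(_ x hx)[_] : convex_hull S `<=` [set y | convex_hull S y /\ y <> x].
  apply: convex_hull_sub => [y z t t01 [hy yx] [hz zx]|y Sy]; last first.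
    by split=> [|yx]; [exact: sub_convex_hull | apply: Sx; rewrite -yx].
  split; first exact: convex_hull_conv.
  move=> yzx; have [t0 t1] := andP t01.
  case: (ltgtP 0 t) t0 => // [t0 _|t0 _]; last first.
    by apply: zx; rewrite -yzx -t0 scale0r add0r subr0 scale1r.
  case: (ltgtP t 1) t1 => // [t1 _|t1 _]; last first.
    by apply: yx; rewrite -yzx t1 subrr scale0r addr0 scale1r.
  by have [] := ext y z t hy hz _ yzx; first by rewrite t0 t1.
exact.
Qed.

(** The weighted averages of the [v i] already form a convex set, which contains each [v i] through
    Kronecker delta weights, so the smallest such set lies inside it. *)
Lemma convex_hull_range (n : nat) (v : 'I_n -> V) x :
  convex_hull (range v) x ->
  exists c : 'I_n -> R,
    [/\ forall i, 0 <= c i, \sum_i c i = 1 & \sum_i c i *: v i = x].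
Proof.
apply: (convex_hull_sub (K := [set x | exists c : 'I_n -> R,
    [/\ forall i, 0 <= c i, \sum_i c i = 1 & \sum_i c i *: v i = x]])).
  move=> {}x y t /andP[t0 t1] [c [c0 c1 <-]] [d [d0 d1 <-]].
  exists (fun i => t * c i + (1 - t) * d i); split.
  - by move=> i; rewrite addr_ge0 ?mulr_ge0 ?subr_ge0.
  - by rewrite big_split/= -!mulr_sumr c1 d1; lra.
  - rewrite !scaler_sumr -big_split/=; apply: eq_bigr => i _.
    by rewrite scalerDl !scalerA.
move=> _ [i _ <-]; exists (fun j => (j == i)%:R); split=> [j||].
- by rewrite ler0n.
- by rewrite (bigD1 i)//= eqxx big1 ?addr0// => j /negPf->.
- rewrite (bigD1 i)//= eqxx scale1r big1 ?addr0// => j /negPf->.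
  by rewrite scale0r.
Qed.

(* Comparing affine coordinates: the coefficient of v k on the left is at least
   1, so it exhausts the total mass. *)
Lemma vertex_add_hull (n : nat) (v : 'I_n -> V) (k k0 : 'I_n) y z :
  affine_indep v -> v k0 = 0 -> k != k0 ->
  convex_hull (range v) y -> convex_hull (range v) z ->
  v k + y = z -> z = v k.
Proof.
move=> indep v0 kk0 /convex_hull_range[c [c0 c1 <-]].
move=> /convex_hull_range[d [d0 d1 <-]] vE.
have sum_delta (j : 'I_n) : \sum_i (i == j)%:R = 1 :> R.
  by rewrite (bigD1 j)//= eqxx big1 ?addr0// => i /negPf->.
have sum_deltav (j : 'I_n) : \sum_i (i == j)%:R *: v i = v j.
  rewrite (bigD1 j)//= eqxx scale1r big1 ?addr0// => i /negPf->.
  by rewrite scale0r.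
(* Subtracting the delta at [k0] brings the total of the coefficients to 0 and leaves the vector
   unchanged because [v k0 = 0]. *)
have /= b0 : forall i, (i == k)%:R + c i - (i == k0)%:R - d i = 0.
  apply: indep; last first.
    under eq_bigr do rewrite !(scalerDl, scaleNr).
    by rewrite !(big_split, sumrN)/= !sum_deltav v0 vE subr0 subrr.
  by rewrite !(big_split, sumrN)/= !sum_delta c1 d1 addrK subrr.
have dk : 1 <= d k.
  by have := b0 k; have := c0 k; rewrite eqxx (negPf kk0) mulr1n mulr0n; lra.
have d_other : \sum_(i | i != k) d i = 0.
  apply/eqP; rewrite eq_le sumr_ge0 ?andbT//.
  by move: d1; rewrite (bigD1 k)//=; lra.
have dk1 : d k = 1 by move: d1; rewrite (bigD1 k)//= d_other addr0.
rewrite (bigD1 k)//= dk1 scale1r big1 ?addr0// => i ik.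
suff -> : d i = 0 by rewrite scale0r.
by apply: (psumr_eq0P _ d_other) ik => j _.
Qed.

End Convexity.

(** * Transport along the strict monoidal equalities *)

Section Cast.
Variable C : strictSymMonCat.

Lemma castHom_seqc (X X' Y Y' Z Z' : sys C) (eX : X = X') (eY : Y = Y')
    (eZ : Z = Z') (g : ev Y Z) (f : ev X Y) :
  castHom eX eZ (seqc g f) = seqc (castHom eY eZ g) (castHom eX eY f).
Proof. by case: _ / eX; case: _ / eY; case: _ / eZ. Qed.

Lemma castHom_cancell (X X' Y Y' : sys C) (eX : X = X') (eY : Y = Y')
    (f : ev X Y) (g : ev X Y') :
  castHom eX eY f = castHom eX erefl g -> castHom erefl eY f = g.
Proof. by case: _ / eX; case: _ / eY g. Qed.

(* An effect a on the ancilla commutes past E, so that any context of an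
   effect amounts to a single state. *)
Lemma effect_context (A B : sys C) (rho : ev triv (tens A B))
    (a : ev (tens triv B) triv) :
  exists rho' : ev triv A, forall E : ev A triv,
    seqc a (seqc (parc E (idev B)) rho) = seqc E rho'.
Proof.
pose a' : ev B triv := castHom (tensIs B) erefl a.
have aE : castHom erefl (tensIs triv) (parc (idev triv) a') = a.
  exact: (castHom_cancell (parcIl a')).
(* The witness is [rho] with its ancilla measured by [a']. *)
exists (seqc (castHom erefl (tenssI A) (parc (idev A) a')) rho) => E.
rewrite !seqcA; congr (seqc _ rho).
rewrite -aE -[parc E _]/(castHom erefl erefl _).
rewrite -castHom_seqc parc_seqc seqcIl seqcIr.
rewrite -[X in _ = seqc X _]parcIr -castHom_seqc parc_seqc seqcIl seqcIr.
(* The two sides collapse [tens triv triv] by the left and the right unit law respectively. *)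
by rewrite (Prop_irrelevance (tensIs triv) (tenssI triv)).
Qed.

End Cast.

(** * Deterministic effects: existence and uniqueness *)

Section Causality.
Variables (R : realType) (T : opt R).
Implicit Types A B : sys T.

Lemma effect_ext A (e f : ev A triv) :
  (forall rho, pairing e rho = pairing f rho) -> e = f.
Proof.
move=> ef; apply: ev_ext => C rho a.
by have [rho' eq_rho'] := effect_context rho a; rewrite !eq_rho'; exact: ef.
Qed.

(** The axioms on coarse-graining concern tests only, so [a] is completed to a test [u] with
    [u z = a], and the composite test is coarse-grained over the product of [Y] and [[set z]]. *)
Lemma pairing_coarse A (X : finType) (t : X -> ev triv A) (Y : {set X})
    (a : ev A triv) :
  test t -> pairing a (coarse t Y) = \sum_(x in Y) pairing a (t x).
Proof.
move=> ht; have [Z [u [tu [z <-]]]] := ev_in_test a.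
rewrite /pairing -[in LHS](coarse1 z tu) -coarse_seqc// prob_coarse; last first.
  exact: test_seqc.
rewrite (eq_bigl (fun p => (p.1 \in Y) && (p.2 == z))); last first.
  by move=> p; rewrite !inE.
rewrite -(pair_big (mem Y) (pred1 z) (fun x y => prob (seqc (u y) (t x))))/=.
by apply: eq_bigr => x _; rewrite big_pred1_eq.
Qed.

Lemma pairing_deterministic A (X : finType) (t : X -> ev triv A)
    (e : ev A triv) :
  test t -> deterministic e -> pairing e (coarse t [set: X]%SET) = 1.
Proof.
move=> ht te; rewrite pairing_coarse// -(prob_test (test_seqc ht te)).
rewrite (eq_bigl predT); last by move=> x; rewrite inE.
rewrite -(pair_big predT predT (fun x (y : unit) => prob (seqc e (t x))))/=.
by apply: eq_bigr => x _; rewrite big_const card_unit /= addr0.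
Qed.

Lemma deterministic_effect_exists A : exists e : ev A triv, deterministic e.
Proof.
have [X [t ht]] := observation_test A; have [Y [u hu]] := preparation_test A.
have [x] : inhabited X.
  (* A test with no outcome would yield an empty probability distribution. *)
  apply: contrapT => X0; have := prob_test (test_seqc hu ht).
  rewrite big1 => [/eqP|[y x]]; first by rewrite eq_sym oner_eq0.
  by case: X0.
(* All outcomes are merged: this set is the preimage of [tt], in the form given by [test_merge]. *)
exists (coarse t [set y | tt == tt]%SET).
have surj (z : unit) : exists y : X, tt = z by exists x; case: z.
by congr test: (test_merge ht surj); apply/funext => -[].
Qed.

Lemma coarse_St A (X : finType) (t : X -> ev triv A) (Y : {set X}) :
  test t -> \sum_(x in Y) state_vec (t x) = state_vec (coarse t Y).
Proof.
by move=> ht; apply/funext => a; rewrite fct_sumE /state_vec pairing_coarse.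
Qed.

Lemma St0 A : @St R T A 0.
Proof.
have [X [t ht]] := preparation_test A.
by exists (coarse t finset.set0) => //; rewrite -coarse_St// big_set0.
Qed.

(** Every function in the hull is nonnegative, so a proper mixture equal to 0 has both components
    0. *)
Lemma ExtSt0 A : @ExtSt R T A 0.
Proof.
have hull_ge0 : convex_hull (@St R T A) `<=` [set f | forall a, 0 <= f a].
  apply: convex_hull_sub => [f g s /andP[s0 s1] f0 g0 a|_ [rho _ <-] a].
    by apply: addr_ge0; apply: mulr_ge0; rewrite ?subr_ge0.
  exact: (prob_ge0 (seqc a rho)).
split=> [|f g s /hull_ge0 f0 /hull_ge0 g0 /andP[s0 s1] fg].
  by apply: sub_convex_hull; exact: St0.
have fg0 a : f a = 0 /\ g a = 0.
  have /= /eqP := congr1 (fun h => h a) fg.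
  rewrite paddr_eq0 ?mulr_ge0 ?(ltW s0) ?subr_ge0 ?(ltW s1)//.
  rewrite !mulf_eq0 subr_eq0 (gt_eqF s0) (gt_eqF s1) /=.
  by move=> /andP[/eqP-> /eqP->].
by split; apply/funext => a; have [] := fg0 a.
Qed.

Lemma pairing_vertex A (n : nat) (v : 'I_n -> ev A triv -> R^o)
    (k k0 : 'I_n) (e : ev A triv) :
  affine_indep v -> range v = @ExtSt R T A ->
  convex_hull (range v) = convex_hull (@St R T A) ->
  v k0 = 0 -> k != k0 -> deterministic e -> v k e = 1.
Proof.
move=> indep vE hullE v0 kk0 dete.
(* As an extreme point, the vertex is a genuine state and not just a mixture, so it occurs in a
   test. *)
have [rho _ rhoE] : @St R T A (v k).
  by apply: extreme_points_hull; rewrite -/(@ExtSt R T A) -vE; exists k.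
have [X [t [ht [x tx]]]] := ev_in_test rho.
have in_hull (Y : {set X}) : convex_hull (range v) (state_vec (coarse t Y)).
  by rewrite hullE; apply: sub_convex_hull; exists (coarse t Y).
have <- : state_vec (coarse t [set: X]%SET) = v k.
  apply: (vertex_add_hull indep v0 kk0 (in_hull [set~ x]%SET) (in_hull _)).
  rewrite -!coarse_St// -rhoE -tx [RHS](bigD1 x) ?inE//=; congr (_ + _).
  by apply: eq_bigl => y; rewrite !inE.
exact: pairing_deterministic.
Qed.

Lemma deterministic_effect_unique A (e f : ev A triv) :
  finite_dimensional T -> simplicial T ->
  deterministic e -> deterministic f -> e = f.
Proof.
move=> fin simp dete detf; apply: effect_ext => rho.
have [D /simp[v [_ vE indep hullE]]] := fin A.
have [k0 _ v0] : range v 0 by rewrite vE; exact: ExtSt0.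
(* Agreement at [e] and [f] is preserved by mixing, so it suffices to check the vertices: both
   values are 0 at the null one and 1 at the others. *)
have agree : convex_hull (@St R T A) `<=` [set g | g e = g f].
  rewrite -hullE; apply: convex_hull_sub => [g h s _ ge he|_ [k _ <-]] /=.
    by rewrite !fctE ge he.
  have [->|kk0] := eqVneq k k0; first by rewrite v0.
  by rewrite !(pairing_vertex indep vE hullE v0 kk0).
by apply: (agree (state_vec rho)); apply: sub_convex_hull; exists rho.
Qed.

End Causality.

Theorem theorem1 (R : realType) (Theta : opt R)
    (hfin : finite_dimensional Theta) (hsimp : simplicial Theta) :
  causal Theta.
Proof.
move=> A; have [e dete] := deterministic_effect_exists A.
by exists e; split=> // f; exact: deterministic_effect_unique.
Qed.
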